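(* Let $Q$ be a commutative semicartesian quantale. The gluing completion functor $\mathcal{G}:\mathbf{QSet}_f\to\mathbf{GlueQSet}$ is left adjoint to the full inclusion $\mathbf{GlueQSet}\hookrightarrow\mathbf{QSet}_f$; that is, it is the reflector of the full subcategory of gluing-complete $Q$-sets.
   Context: A quantale is a complete lattice $(Q,\le)$ with an associative binary operation $\otimes$ that distributes over arbitrary suprema in each variable. It is commutative if $\otimes$ is commutative and semicartesian if $a\otimes b\le a\wedge b$ for all $a,b$. A $Q$-set is a set $X$ with a map $\delta:X\times X\to Q$ such that for all $x,y,z$: $\delta(x,y)=\delta(y,x)$; $\delta(x,y)\otimes\delta(y,z)\le\delta(x,z)$; $\delta(x,x)\otimes\delta(x,y)=\delta(x,y)$. The extent of $x$ is $Ex:=\delta(x,x)$. $\mathbf{QSet}_f$ is the category of $Q$-sets with functional morphisms: functions $f:X\to Y$ with $\delta(x,x')\le\delta(f(x),f(x'))$ and $Ef(x)=Ex$, composed as functions. A compatible family of $X$ is a (possibly empty) subset $A\subseteq X$ with $\delta(a,b)=Ea\otimes Eb$ for all $a,b\in A$. An element $x_A\in X$ is a gluing of $A$ if $\delta(a,x_A)=Ea$ for all $a\in A$ and $Ex_A=\bigvee_{a\in A}Ea$. $X$ is gluing-complete if every compatible family has exactly one gluing. $\mathbf{GlueQSet}$ is the full subcategory of $\mathbf{QSet}_f$ on gluing-complete $Q$-sets. $\mathfrak{G}(X)$ is the $Q$-set whose elements are the compatible families of $X$, with $\delta(A,B)=\bigvee_{a\in A,\,b\in B}\delta(a,b)$;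 on a functional morphism $f$, $\mathfrak{G}(f)(A)=f[A]$ (direct image). Two elements $x,y$ of a $Q$-set are $\delta$-equivalent if $\delta(x,y)=Ex=Ey$. The functor $(-)/\delta$ sends a $Q$-set $X$ to its quotient by $\delta$-equivalence with $\delta([x],[y])=\delta(x,y)$, and $f$ to $[x]\mapsto[f(x)]$. The gluing completion functor is $\mathcal{G}:=((-)/\delta)\circ\mathfrak{G}$; it takes values in $\mathbf{GlueQSet}$. *)

(* Defs.v *)
From HB Require Import structures.
From mathcomp Require Import all_boot all_order.
From mathcomp Require Import boolp classical_sets.

Set Implicit Arguments.
Unset Strict Implicit.
Unset Printing Implicit Defensive.

Import Order.TTheory.
Local Open Scope classical_set_scope.
Local Open Scope order_scope.

(* Suprema of all subsets suffice for completeness: the infimum of A is the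
   supremum of the set of its lower bounds. *)
HB.mixin Record Lattice_isComplete d Q of Order.Lattice d Q := {
  qsup : set Q -> Q;
  qsupP : forall S : set Q, supremums S (qsup S)
}.

#[short(type="completeLatticeType")]
HB.structure Definition CompleteLattice d :=
  { Q of Order.Lattice d Q & Lattice_isComplete d Q }.

HB.mixin Record CompleteLattice_isQuantale d Q of CompleteLattice d Q := {
  qmul : Q -> Q -> Q;
  qmulA : associative qmul;
  qmul_supr : forall (a : Q) (S : set Q),
    qmul a (qsup S) = qsup [set qmul a b | b in S];
  qmul_supl : forall (S : set Q) (a : Q),
    qmul (qsup S) a = qsup [set qmul b a | b in S]
}.

#[short(type="quantaleType")]
HB.structure Definition Quantale d :=
  { Q of CompleteLattice d Q & CompleteLattice_isQuantale d Q }.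

Notation "a ⊗ b" := (qmul a b) (at level 40, left associativity).

HB.mixin Record Quantale_isCommSemicartesian d Q of Quantale d Q := {
  qmulC : commutative (qmul : Q -> Q -> Q);
  qmul_le_meet : forall a b : Q, a ⊗ b <= Order.meet a b
}.

#[short(type="commSemicartQuantaleType")]
HB.structure Definition CommSemicartQuantale d :=
  { Q of Quantale d Q & Quantale_isCommSemicartesian d Q }.

Record category := Category {
  obj : Type;
  hom : obj -> obj -> Type;
  idm : forall a, hom a a;
  comp : forall a b c, hom b c -> hom a b -> hom a c;
  comp_idl : forall a b (f : hom a b), comp (idm b) f = f;
  comp_idr : forall a b (f : hom a b), comp f (idm a) = f;
  compA : forall a b c e (h : hom c e) (g : hom b c) (f : hom a b),
    comp h (comp g f) = comp (comp h g) f
}.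
Arguments hom {_} _ _.
Arguments idm {_} _.
Arguments comp {_ _ _ _} _ _.

Record functor (C D : category) := Functor {
  fobj :> obj C -> obj D;
  fmap : forall a b, hom a b -> hom (fobj a) (fobj b);
  fmap_id : forall a, fmap (idm a) = idm (fobj a);
  fmap_comp : forall a b c (g : hom b c) (f : hom a b),
    fmap (comp g f) = comp (fmap g) (fmap f)
}.
Arguments fmap {_ _} _ {_ _} _.

Definition functor_comp (B C D : category) (G : functor C D) (F : functor B C) :
  functor B D.
Proof.
refine (@Functor B D (fun a => G (F a)) (fun a b f => fmap G (fmap F f)) _ _).
- by move=> a; rewrite !fmap_id.
- by move=> a b c g f; rewrite !fmap_comp.
Defined.

(* By construction a morphism of full_subcat P is a morphism of C. *)
Definition full_subcat (C : category) (P : obj C -> Prop) : category :=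
  @Category {a : obj C | P a} (fun a b => hom (sval a) (sval b))
    (fun a => idm (sval a)) (fun a b c g f => comp g f)
    (fun a b f => comp_idl f) (fun a b f => comp_idr f)
    (fun a b c e h g f => compA h g f).

Definition full_incl (C : category) (P : obj C -> Prop) :
    functor (full_subcat P) C :=
  @Functor (full_subcat P) C (fun a => sval a) (fun a b f => f)
    (fun a => erefl) (fun a b c g f => erefl).

Definition corestrict (C D : category) (P : obj D -> Prop) (F : functor C D)
    (FP : forall a, P (F a)) : functor C (full_subcat P) :=
  @Functor C (full_subcat P) (fun a => exist P (F a) (FP a))
    (fun a b f => fmap F f) (fun a => fmap_id F a)
    (fun a b c g f => fmap_comp F g f).

(* A bijection hom (L c) a ~ hom c (R a), natural in c and in a. *)
Definition left_adjoint (C D : category) (L : functor C D) (R : functor D C) :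
    Prop :=
  exists phi : forall (c : obj C) (a : obj D), hom (L c) a -> hom c (R a),
    [/\ forall c a, bijective (phi c a),
        forall c c' a (f : hom c' c) (h : hom (L c) a),
          phi c' a (comp h (fmap L f)) = comp (phi c a h) f
      & forall c a a' (g : hom a a') (h : hom (L c) a),
          phi c a' (comp g h) = comp (fmap R g) (phi c a h)].

Record qset d (Q : quantaleType d) := QSet {
  qcarrier :> Type;
  delta : qcarrier -> qcarrier -> Q;
  deltaC : forall x y, delta x y = delta y x;
  delta_trans : forall x y z, delta x y ⊗ delta y z <= delta x z;
  delta_ext : forall x y, delta x x ⊗ delta x y = delta x y
}.

Definition extent d (Q : quantaleType d) (X : qset Q) (x : X) : Q := delta x x.

Record qhom d (Q : quantaleType d) (X Y : qset Q) := QHom {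
  qfun :> X -> Y;
  qhom_delta : forall x x', delta x x' <= delta (qfun x) (qfun x');
  qhom_extent : forall x, extent (qfun x) = extent x
}.

Lemma qhom_eq d (Q : quantaleType d) (X Y : qset Q) (f g : qhom X Y) :
  f =1 g -> f = g.
Proof.
case: f g => [f f1 f2] [g g1 g2] /= /funext fg; subst g.
by congr QHom; exact: Prop_irrelevance.
Qed.

Definition qhom_id d (Q : quantaleType d) (X : qset Q) : qhom X X :=
  @QHom d Q X X id (fun _ _ => lexx _) (fun _ => erefl).

Definition qhom_comp d (Q : quantaleType d) (X Y Z : qset Q)
  (g : qhom Y Z) (f : qhom X Y) : qhom X Z.
Proof.
refine (@QHom d Q X Z (g \o f) _ _) => [x x'|x] /=.
- exact: le_trans (qhom_delta f x x') (qhom_delta g _ _).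
- by rewrite !qhom_extent.
Defined.

Definition QSetf d (Q : quantaleType d) : category.
Proof.
refine (@Category (qset Q) (@qhom d Q) (@qhom_id d Q) (@qhom_comp d Q) _ _ _).
all: by move=> *; exact: qhom_eq.
Defined.

Section Gluing.
Context d (Q : quantaleType d) (X : qset Q).
Implicit Types (A : set X) (x y : X).

Definition compatible A : Prop :=
  forall a b, A a -> A b -> delta a b = extent a ⊗ extent b.

Definition is_gluing A x : Prop :=
  (forall a, A a -> delta a x = extent a) /\
  extent x = qsup [set extent a | a in A].

Definition gluing_complete : Prop :=
  forall A, compatible A -> exists! x, is_gluing A x.

Definition delta_equiv x y : Prop := delta x y = extent x /\ extent x = extent y.

End Gluing.

Definition GlueQSet d (Q : quantaleType d) : category :=
  full_subcat (C := QSetf Q) (@gluing_complete d Q).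

Definition GlueQSet_incl d (Q : quantaleType d) :
    functor (GlueQSet Q) (QSetf Q) :=
  full_incl (C := QSetf Q) (@gluing_complete d Q).

Section QuantaleTheory.
Context d (Q : commSemicartQuantaleType d).
Implicit Types (a b c : Q) (S : set Q).

Lemma qsup_ub S a : S a -> a <= qsup S.
Proof. by have [+ _] := qsupP S; apply. Qed.

Lemma qsup_le S b : (forall a, S a -> a <= b) -> qsup S <= b.
Proof. by have [_ +] := qsupP S; apply. Qed.

Lemma qmul_lel a b : a ⊗ b <= a.
Proof. exact: le_trans (qmul_le_meet a b) (leIl _ _). Qed.

Lemma qmul_ler a b : a ⊗ b <= b.
Proof. exact: le_trans (qmul_le_meet a b) (leIr _ _). Qed.

Lemma qmul_mono2l a b c : b <= c -> a ⊗ b <= a ⊗ c.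
Proof.
move=> bc; have -> : c = qsup [set e | e = b \/ e = c].
  apply/le_anti/andP; split; first by apply: qsup_ub; right.
  by apply: qsup_le => e [->|->].
by rewrite qmul_supr; apply: qsup_ub; exists b => //; left.
Qed.

Lemma qmul_mono a a' b b' : a <= a' -> b <= b' -> a ⊗ b <= a' ⊗ b'.
Proof.
move=> aa bb; apply: le_trans (qmul_mono2l a bb) _.
by rewrite qmulC [leRHS]qmulC; exact: qmul_mono2l.
Qed.

Variable X : qset Q.
Implicit Types (x y z : X) (A B : set X).

Lemma extent_idem x : extent x ⊗ extent x = extent x.
Proof. exact: delta_ext. Qed.

Lemma extent_deltal x y : extent x ⊗ delta x y = delta x y.
Proof. exact: delta_ext. Qed.

Lemma extent_deltar x y : delta x y ⊗ extent y = delta x y.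
Proof. by rewrite qmulC deltaC; exact: delta_ext. Qed.

Lemma delta_lel x y : delta x y <= extent x.
Proof. by rewrite -extent_deltal; exact: qmul_lel. Qed.

Lemma delta_ler x y : delta x y <= extent y.
Proof. by rewrite deltaC; exact: delta_lel. Qed.

Lemma delta_le_extent x y : delta x y <= extent x ⊗ extent y.
Proof.
by rewrite -extent_deltal; apply: qmul_mono => //; exact: delta_ler.
Qed.

Lemma delta_equiv_refl x : delta_equiv x x.
Proof. by []. Qed.

Lemma delta_equiv_sym x y : delta_equiv x y -> delta_equiv y x.
Proof. by move=> [h1 h2]; split; rewrite // deltaC h1. Qed.

Lemma delta_equiv_le x x' y : delta_equiv x x' -> delta x y <= delta x' y.
Proof.
move=> [h1 h2]; rewrite -extent_deltal -h1 deltaC; exact: delta_trans.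
Qed.

Lemma delta_equivl x x' y : delta_equiv x x' -> delta x y = delta x' y.
Proof.
move=> h; apply/le_anti; rewrite delta_equiv_le//=.
exact/delta_equiv_le/delta_equiv_sym.
Qed.

Lemma delta_equivr x y y' : delta_equiv y y' -> delta x y = delta x y'.
Proof. by move=> h; rewrite deltaC (delta_equivl _ h) deltaC. Qed.

Lemma delta_equiv_trans x y z :
  delta_equiv x y -> delta_equiv y z -> delta_equiv x z.
Proof.
move=> xy yz; split; last by rewrite xy.2 yz.2.
by rewrite (delta_equivl _ xy) yz.1 xy.2.
Qed.

End QuantaleTheory.

Lemma qhom_delta_equiv d (Q : commSemicartQuantaleType d) (X Y : qset Q)
  (f : qhom X Y) (x y : X) : delta_equiv x y -> delta_equiv (f x) (f y).
Proof.
move=> [h1 h2]; split; last by rewrite !qhom_extent.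
apply/le_anti; rewrite delta_lel/= qhom_extent -h1; exact: qhom_delta.
Qed.

Record cfamily d (Q : quantaleType d) (X : qset Q) := CFamily {
  cfam :> set X;
  cfam_compatible : compatible cfam
}.

Section CompatibleFamilies.
Context d (Q : commSemicartQuantaleType d).

Lemma cfamily_eq (X : qset Q) (A B : cfamily X) : cfam A = cfam B -> A = B.
Proof.
case: A B => [A hA] [B hB] /= AB; subst B.
by congr CFamily; exact: Prop_irrelevance.
Qed.

Section Fam.
Variable X : qset Q.
Implicit Types A B C : cfamily X.

Definition fam_delta A B : Q := qsup [set delta a b | a in A & b in B].

Lemma fam_delta_ub A B a b :
  cfam A a -> cfam B b -> delta a b <= fam_delta A B.
Proof. by move=> Aa Bb; apply: qsup_ub; exists a => //; exists b. Qed.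

Lemma fam_delta_le A B c :
  (forall a b, cfam A a -> cfam B b -> delta a b <= c) -> fam_delta A B <= c.
Proof. by move=> h; apply: qsup_le => _ [a Aa [b Bb <-]]; exact: h. Qed.

Lemma fam_deltaC A B : fam_delta A B = fam_delta B A.
Proof.
by apply/le_anti/andP; split; apply: fam_delta_le => a b ? ?;
  rewrite deltaC; exact: fam_delta_ub.
Qed.

Lemma fam_delta_trans A B C :
  fam_delta A B ⊗ fam_delta B C <= fam_delta A C.
Proof.
rewrite {1}/fam_delta qmul_supl; apply: qsup_le => _ [_ [a Aa [b Bb <-]] <-].
rewrite /fam_delta qmul_supr; apply: qsup_le => _ [_ [b' Bb' [c Cc <-]] <-].
apply: le_trans (fam_delta_ub Aa Cc).
rewrite -[delta a b]extent_deltar -[delta b' c]extent_deltal.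
rewrite !qmulA -[X in X ⊗ _]qmulA -(cfam_compatible Bb Bb').
by apply: le_trans (delta_trans a b' c); apply: qmul_mono => //; exact: delta_trans.
Qed.

Lemma fam_delta_ext A B : fam_delta A A ⊗ fam_delta A B = fam_delta A B.
Proof.
apply/le_anti; rewrite qmul_ler/=; apply: fam_delta_le => a b Aa Bb.
by rewrite -extent_deltal; apply: qmul_mono; exact: fam_delta_ub.
Qed.

Definition fam_qset : qset Q :=
  QSet fam_deltaC fam_delta_trans fam_delta_ext.

Lemma fam_extent (A : fam_qset) : extent A = qsup [set extent a | a in cfam A].
Proof.
apply/le_anti/andP; split.
- apply: fam_delta_le => a b Aa Bb; apply: le_trans (delta_lel a b) _.
  by apply: qsup_ub; exists a.
- by apply: qsup_le => _ [a Aa <-]; exact: fam_delta_ub.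
Qed.

End Fam.

Lemma image_compatible (X Y : qset Q) (f : qhom X Y) (A : cfamily X) :
  compatible [set f x | x in A].
Proof.
move=> _ _ [a Aa <-] [b Bb <-]; apply/le_anti; rewrite delta_le_extent/=.
by rewrite !qhom_extent -(cfam_compatible Aa Bb); exact: qhom_delta.
Qed.

Definition fam_map (X Y : qset Q) (f : qhom X Y) :
  qhom (fam_qset X) (fam_qset Y).
Proof.
refine (@QHom d Q (fam_qset X) (fam_qset Y)
  (fun A => CFamily (@image_compatible X Y f A)) _ _) => [A B|A].
- apply: fam_delta_le => a b Aa Bb; apply: le_trans (qhom_delta f a b) _.
  by apply: fam_delta_ub; [exists a|exists b].
- rewrite !fam_extent /=; congr qsup; rewrite image_comp.
  by apply: eq_imagel => x _ /=; rewrite qhom_extent.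
Defined.

Definition fam_functor : functor (QSetf Q) (QSetf Q).
Proof.
refine (@Functor (QSetf Q) (QSetf Q) fam_qset fam_map _ _).
- by move=> X; apply: qhom_eq => A; apply: cfamily_eq => /=; exact: image_id.
- move=> X Y Z g f; apply: qhom_eq => A; apply: cfamily_eq => /=.
  by rewrite image_comp.
Defined.

End CompatibleFamilies.

Section DeltaQuotient.
Context d (Q : commSemicartQuantaleType d).

Section Quot.
Variable X : qset Q.

Definition delta_class (x : X) : set X := [set y | delta_equiv x y].

Definition delta_quot : Type := {C : set X | range delta_class C}.

Definition quot_pi (x : X) : delta_quot :=
  exist _ (delta_class x) (ex_intro2 _ _ x I erefl).

(* quot_delta and quot_map below go through chosen representatives;
   quot_deltaE and quot_mapE give their values on the class of any x. *)
Definition quot_repr (c : delta_quot) : X := sval (cid2 (svalP c)).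

Lemma quot_reprK c : quot_pi (quot_repr c) = c.
Proof.
case: c => C hC; rewrite /quot_pi /quot_repr /=.
by case: cid2 => x _ /= E; subst C; congr exist; exact: Prop_irrelevance.
Qed.

Lemma quot_piP x y : quot_pi x = quot_pi y <-> delta_equiv x y.
Proof.
split=> [/(congr1 sval) /= E|xy].
- by suff : delta_class x y by []; rewrite E; exact: delta_equiv_refl.
- apply: eq_exist => /=; apply/seteqP; split => z /= h.
  + exact: delta_equiv_trans (delta_equiv_sym xy) h.
  + exact: delta_equiv_trans xy h.
Qed.

Lemma quot_piK x : delta_equiv (quot_repr (quot_pi x)) x.
Proof. by apply/quot_piP; rewrite quot_reprK. Qed.

Definition quot_delta (c e : delta_quot) : Q :=
  delta (quot_repr c) (quot_repr e).

Definition quot_qset : qset Q :=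
  @QSet d Q delta_quot quot_delta (fun _ _ => deltaC _ _)
    (fun _ _ _ => delta_trans _ _ _) (fun _ _ => delta_ext _ _).

Lemma quot_deltaE (x y : X) :
  delta (quot_pi x : quot_qset) (quot_pi y) = delta x y.
Proof.
by rewrite /= /quot_delta (delta_equivl _ (quot_piK x))
  (delta_equivr _ (quot_piK y)).
Qed.

Lemma quot_extentE (x : X) : extent (quot_pi x : quot_qset) = extent x.
Proof. exact: quot_deltaE. Qed.

End Quot.

Definition quot_map (X Y : qset Q) (f : qhom X Y) :
  qhom (quot_qset X) (quot_qset Y).
Proof.
refine (@QHom d Q (quot_qset X) (quot_qset Y)
  (fun c => quot_pi (f (quot_repr c))) _ _) => [c e|c].
- by rewrite quot_deltaE; exact: (qhom_delta f (quot_repr c) (quot_repr e)).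
- by rewrite quot_extentE; exact: (qhom_extent f (quot_repr c)).
Defined.

Lemma quot_mapE (X Y : qset Q) (f : qhom X Y) (x : X) :
  quot_map f (quot_pi x) = quot_pi (f x).
Proof. by apply/quot_piP/qhom_delta_equiv/quot_piK. Qed.

Definition quot_functor : functor (QSetf Q) (QSetf Q).
Proof.
refine (@Functor (QSetf Q) (QSetf Q) quot_qset quot_map _ _).
- by move=> X; apply: qhom_eq => c; exact: quot_reprK.
- move=> X Y Z g f; apply: qhom_eq => c /=.
  by apply/esym; exact: quot_mapE.
Defined.

End DeltaQuotient.

Section GluingCompletion.
Context d (Q : commSemicartQuantaleType d).

Definition gluing_endofunctor : functor (QSetf Q) (QSetf Q) :=
  functor_comp (quot_functor Q) (fam_functor Q).

Section Complete.
Variables (X : qset Q) (F : set (quot_qset (fam_qset X))).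
Hypothesis Fcompat : compatible F.

Let U : set X := [set x | exists2 c, F c & cfam (quot_repr c) x].

Lemma union_compatible : compatible U.
Proof.
move=> a b [c Fc ca] [e Fe eb]; apply/le_anti; rewrite delta_le_extent/=.
have ac : extent a <= extent c by exact: (fam_delta_ub ca ca).
have be : extent b <= extent e by exact: (fam_delta_ub eb eb).
apply: (@le_trans _ _ (extent a ⊗ delta c e ⊗ extent b)).
  rewrite (Fcompat Fc Fe) -{1}[extent a]extent_idem -{1}[extent b]extent_idem.
  rewrite !qmulA; apply: qmul_mono => //; apply: qmul_mono => //.
  exact: qmul_mono.
rewrite {1}/delta/= /quot_delta /= /fam_delta qmul_supr qmul_supl.
apply: qsup_le => _ [_ [_ [a' ca' [b' eb' <-]] <-] <-].
have -> : extent a ⊗ delta a' b' ⊗ extent b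
    = delta a a' ⊗ delta a' b' ⊗ delta b' b.
  rewrite (cfam_compatible ca ca') (cfam_compatible eb' eb).
  by rewrite -{1}(extent_deltal a' b') -{1}(extent_deltar a' b') !qmulA.
by apply: le_trans (delta_trans a b' b); apply: qmul_mono => //;
  exact: delta_trans.
Qed.

Let V : fam_qset X := CFamily union_compatible.

Lemma union_gluing : is_gluing F (quot_pi V).
Proof.
split=> [c Fc|].
- rewrite -{1}(quot_reprK c) quot_deltaE.
  have <- : extent (quot_repr c) = extent c by [].
  apply/le_anti/andP; split; first exact: delta_lel.
  rewrite fam_extent; apply: qsup_le => _ [a ca <-].
  by apply: fam_delta_ub => //; exists c.
- rewrite quot_extentE fam_extent; apply/le_anti/andP; split.
  + apply: qsup_le => _ [a [c Fc ca] <-].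
    apply: (@le_trans _ _ (extent c)); last by apply: qsup_ub; exists c.
    exact: (fam_delta_ub ca ca).
  + apply: qsup_le => _ [c Fc <-].
    have -> : extent c = extent (quot_repr c) by [].
    rewrite fam_extent; apply: qsup_le => _ [a ca <-].
    by apply: qsup_ub; exists a => //; exists c.
Qed.

End Complete.

Lemma gluing_equiv (X : qset Q) (A : set X) (x y : X) :
  is_gluing A x -> is_gluing A y -> delta_equiv x y.
Proof.
move=> [xA xE] [yA yE]; split; last by rewrite xE yE.
apply/le_anti; rewrite delta_lel/= xE; apply: qsup_le => _ [a Aa <-].
rewrite -extent_idem -{1}(xA a Aa) -(yA a Aa) deltaC; exact: delta_trans.
Qed.

Lemma gluing_endofunctor_complete (X : qset Q) :
  gluing_complete (gluing_endofunctor X).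
Proof.
move=> F Fc; eexists; split; first exact: (union_gluing Fc).
move=> c cF; have := gluing_equiv (union_gluing Fc) cF.
rewrite -[c]quot_reprK /delta_equiv !quot_extentE quot_deltaE.
by move=> h; apply/quot_piP.
Qed.

Definition gluing_completion : functor (QSetf Q) (GlueQSet Q) :=
  corestrict (D := QSetf Q) (P := @gluing_complete d Q) (F := gluing_endofunctor)
    gluing_endofunctor_complete.

End GluingCompletion.

(* Main.v *)
Require Import Defs.
From mathcomp Require Import all_boot all_order.
From mathcomp Require Import boolp classical_sets.

Set Implicit Arguments.
Unset Strict Implicit.
Unset Printing Implicit Defensive.

Import Order.TTheory.
Local Open Scope classical_set_scope.
Local Open Scope order_scope.

(** The unit of the adjunction sends [x] to the class of the one-element family
    [{x}], and the bijection between homs is precomposition with this unit.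
    Naturality holds because the direct image of [{x}] under [f] is [{f x}]
    ([completion_unit_natural]); the content is that the unit is universal.

    The class of a compatible family [A] glues the image of [A] under the unit
    ([unit_gluing]), and functional morphisms preserve gluings ([qhom_gluing]).
    Hence a morphism [h] from the completion of [X] to a gluing-complete [Y]
    has no choice but to send the class of [A] to the unique gluing of the
    image of [A] under [h] composed with the unit: this is uniqueness.

    Conversely, when [Y] is gluing-complete, taking gluings is itself a
    functional morphism from the compatible families of [Y] to [Y]
    ([gluing_qhom]). Composing it with the direct image along [f : X -> Y]
    gives a morphism on the compatible families of [X]. Morphisms preserve
    delta-equivalence, and delta-equivalent elements of a gluing-complete
    [Y] are equal ([gluing_complete_separated]), so this composite descends to
    the quotient ([extension]). It sends the class of [{x}] to the gluing of
    [{f x}], which is [f x]. *)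

Section Adjunction.
Context d (Q : commSemicartQuantaleType d).
Implicit Types X Y : qset Q.

Lemma singleton_compatible X (x : X) : compatible [set x].
Proof. by move=> a b -> ->; rewrite extent_idem. Qed.

Lemma singleton_gluing X (x : X) : is_gluing [set x] x.
Proof.
split=> [a ->//|]; apply/le_anti/andP; split.
- by apply: qsup_ub; exists x.
- by apply: qsup_le => _ [a -> <-].
Qed.

(** Both elements glue the family consisting of the first one. *)
Lemma gluing_complete_separated Y (x y : Y) :
  gluing_complete Y -> delta_equiv x y -> x = y.
Proof.
move=> Yc [xy Exy].
have [z [_ zP]] := Yc _ (@singleton_compatible Y x).
rewrite -(zP x (singleton_gluing x)); apply: zP.
split=> [a ->//|]; rewrite -Exy; exact: (singleton_gluing x).2.
Qed.

Lemma qhom_gluing X Y (f : qhom X Y) (A : set X) (x : X) :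
  is_gluing A x -> is_gluing [set f a | a in A] (f x).
Proof.
move=> [Ax Ex]; split=> [_ [a Aa <-]|].
- apply/le_anti; rewrite delta_lel/= qhom_extent -(Ax a Aa).
  exact: qhom_delta.
- rewrite qhom_extent Ex image_comp; congr qsup.
  by apply: eq_imagel => a _ /=; rewrite qhom_extent.
Qed.

Section Unit.
Variable X : qset Q.

Definition singleton (x : X) : fam_qset X := CFamily (@singleton_compatible X x).

Lemma singleton_deltaE (x : X) (A : fam_qset X) :
  delta (singleton x) A = qsup [set delta x a | a in cfam A].
Proof.
apply/le_anti/andP; split.
- by apply: fam_delta_le => _ b -> Ab; apply: qsup_ub; exists b.
- by apply: qsup_le => _ [a Aa <-]; exact: fam_delta_ub.
Qed.

Lemma singleton_delta (x y : X) : delta (singleton x) (singleton y) = delta x y.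
Proof.
rewrite singleton_deltaE; apply/le_anti/andP; split.
- by apply: qsup_le => _ [a -> <-].
- by apply: qsup_ub; exists y.
Qed.

Definition completion_unit : qhom X (gluing_endofunctor Q X).
Proof.
refine (@QHom d Q X (gluing_endofunctor Q X)
  (fun x => quot_pi (singleton x)) _ _) => [x y|x].
- by rewrite quot_deltaE singleton_delta.
- by rewrite quot_extentE /extent singleton_delta.
Defined.

Lemma unit_gluing (A : fam_qset X) :
  is_gluing [set completion_unit a | a in cfam A]
    (quot_pi A : gluing_endofunctor Q X).
Proof.
split=> [_ [a Aa <-]|].
- rewrite qhom_extent quot_deltaE singleton_deltaE.
  apply/le_anti/andP; split.
  + by apply: qsup_le => _ [b _ <-]; exact: delta_lel.
  + by apply: qsup_ub; exists a.
- rewrite quot_extentE fam_extent image_comp; congr qsup.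
  by apply: eq_imagel => a _; rewrite [RHS]qhom_extent.
Qed.

End Unit.

Lemma completion_unit_natural X Y (f : qhom X Y) (x : X) :
  fmap (gluing_endofunctor Q) f (completion_unit X x)
  = completion_unit Y (f x).
Proof.
rewrite [LHS]quot_mapE; congr quot_pi.
by apply: cfamily_eq; rewrite /= image_set1.
Qed.

Section Extension.
Variable Y : qset Q.
Hypothesis Yc : gluing_complete Y.

Definition gluing (A : cfamily Y) : Y := sval (cid (Yc (@cfam_compatible _ _ _ A))).

Lemma gluingP (A : cfamily Y) : is_gluing (cfam A) (gluing A).
Proof. by rewrite /gluing; case: cid => x []. Qed.

Lemma gluing_unique (A : cfamily Y) (x : Y) :
  is_gluing (cfam A) x -> x = gluing A.
Proof.
move=> Ax; apply: gluing_complete_separated => //.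
exact: gluing_equiv Ax (gluingP A).
Qed.

(** For [a] in [A] and [b] in [B], [delta a b] is unchanged by multiplication
    with [extent a] and [extent b], which are the values of [delta] between [a]
    and the gluing of [A], and between [b] and the gluing of [B]; transitivity
    along the four points then gives the bound. *)
Lemma gluing_delta (A B : cfamily Y) :
  fam_delta A B <= delta (gluing A) (gluing B).
Proof.
apply: fam_delta_le => a b Aa Bb.
rewrite -(extent_deltal a b) -(extent_deltar a b) qmulA.
rewrite -((gluingP A).1 a Aa) -((gluingP B).1 b Bb) (deltaC a).
apply: le_trans (delta_trans _ b _); apply: qmul_mono => //.
exact: delta_trans.
Qed.

Lemma gluing_extent (A : fam_qset Y) : extent (gluing A) = extent A.
Proof. by rewrite (gluingP A).2 fam_extent. Qed.

Definition gluing_qhom : qhom (fam_qset Y) Y :=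
  @QHom d Q (fam_qset Y) Y gluing gluing_delta gluing_extent.

Definition quot_lift X (g : qhom X Y) : qhom (quot_qset X) Y :=
  @QHom d Q (quot_qset X) Y (fun c => g (quot_repr c))
    (fun c e => qhom_delta g (quot_repr c) (quot_repr e))
    (fun c => qhom_extent g (quot_repr c)).

Lemma quot_liftE X (g : qhom X Y) (x : X) : quot_lift g (quot_pi x) = g x.
Proof.
apply: gluing_complete_separated => //.
by apply: (qhom_delta_equiv g); exact: quot_piK.
Qed.

Definition extension X (f : qhom X Y) : qhom (gluing_endofunctor Q X) Y :=
  quot_lift (qhom_comp gluing_qhom (fam_map f)).

Lemma extension_unit X (f : qhom X Y) :
  qhom_comp (extension f) (completion_unit X) = f.
Proof.
apply: qhom_eq => x; rewrite [LHS]quot_liftE; apply/esym/gluing_unique.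
exact/qhom_gluing/singleton_gluing.
Qed.

Lemma unit_extension X (h : qhom (gluing_endofunctor Q X) Y) :
  extension (qhom_comp h (completion_unit X)) = h.
Proof.
apply: qhom_eq => c; rewrite -(quot_reprK c) [LHS]quot_liftE.
apply/esym/gluing_unique => /=.
by have := qhom_gluing h (unit_gluing (quot_repr c)); rewrite image_comp.
Qed.

End Extension.

End Adjunction.

Theorem mainTheorem2 (d : Order.disp_t) (Q : commSemicartQuantaleType d) :
  left_adjoint (gluing_completion Q) (GlueQSet_incl Q).
Proof.
exists (fun X Y h => qhom_comp h (completion_unit X)); split.
- move=> X [Y Yc]; exists (fun f : qhom X Y => extension Yc f).
  + by move=> h; exact: unit_extension.
  + by move=> f; exact: extension_unit.
- move=> X X' Y f h; apply: qhom_eq => x.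
  exact: (congr1 h (completion_unit_natural f x)).
- by move=> X Y Y' g h; exact: qhom_eq.
Qed.
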